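(* Let $p$ be a prime number and let $f \in \mathbb{Z}_p\{x\}$ be the one-variable restricted power series $$f(x) = (x-1)^2 \sum_{i=0}^{\infty} p^i x^i .$$ For an integer $d \ge 0$ let $f_d$ denote the polynomial consisting of all terms of (the expanded power series) $f$ of degree $\le d$. Then for every integer $D \ge 1$ the Igusa zeta functions $Z_{f_{2D}}$ and $Z_f$ are not equal (as functions on $\{s \in \mathbb{C} : \Re(s) > 0\}$). In particular, there is no $N \in \mathbb{N}$ such that $Z_{f_{d}} = Z_f$ for all $d \ge N$.
   Context: $\mathbb{Z}_p\{x\}$ is the ring of restricted power series over $\mathbb{Z}_p$ in one variable: formal power series $\sum_{i \ge 0} a_i x^i$ with $a_i \in \mathbb{Z}_p$ and $|a_i|_p \to 0$ as $i \to \infty$. Such a series converges at every $x \in \mathbb{Z}_p$. For $g \in \mathbb{Z}_p\{x\}$ and $s \in \mathbb{C}$ with $\Re(s) > 0$, the Igusa zeta function is $Z_g(s) = \int_{\mathbb{Z}_p} |g(x)|_p^s\, |dx|$, where $|dx|$ is the Haar measure on $\mathbb{Q}_p$ normalized so that $\mathbb{Z}_p$ has measure $1$, $|\cdot|_p$ is the $p$-adic absolute value with $|p|_p = p^{-1}$, and $|0|_p^s = 0$. *)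

(* Defs.v *)
From HB Require Import structures.
From mathcomp Require Import all_boot all_order all_algebra.
From mathcomp Require Import all_classical all_reals all_analysis.
From mathcomp Require Import complex.
From mathcomp Require Import cyclic zify lra.
Set Implicit Arguments.
Unset Strict Implicit.
Unset Printing Implicit Defensive.
Import Order.TTheory GRing.Theory Num.Theory.
Import numFieldNormedType.Exports.
Local Open Scope classical_set_scope.
Local Open Scope ring_scope.

(* The ring of p-adic integers as the inverse limit of the rings Z/p^n:
   [residue x n] is the representative of x modulo p^n in [0, p^n); the
   bound residue x n < p^n follows from the compatibility condition. *)
Record padic_int (p : nat) (p_pr : prime p) := PadicInt {
  residue :> nat -> nat ;
  residueE : forall n, (residue n = residue n.+1 %% p ^ n)%N
}.

HB.instance Definition _ p (p_pr : prime p) := gen_eqMixin (padic_int p_pr).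
HB.instance Definition _ p (p_pr : prime p) := gen_choiceMixin (padic_int p_pr).

Section PadicIntRing.
Variables (p : nat) (p_pr : prime p).
Local Notation Z_p := (padic_int p_pr).
Implicit Types x y z : Z_p.

Let p_gt0 : (0 < p)%N. Proof. exact: prime_gt0. Qed.
Let pX_gt0 n : (0 < p ^ n)%N. Proof. by rewrite expn_gt0 p_gt0. Qed.

Lemma padic_intP x y : (forall n, x n = y n) -> x = y.
Proof.
case: x y => [x hx] [y hy] /= xy.
have {}xy : x = y by apply: funext.
by rewrite xy in hx *; congr PadicInt; exact: Prop_irrelevance.
Qed.

Lemma residue_lt x n : (x n < p ^ n)%N.
Proof. by rewrite residueE ltn_mod. Qed.

Lemma residue_mod x n m : (n <= m)%N -> (x m %% p ^ n)%N = x n.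
Proof.
move=> /subnK <-; elim: (m - n)%N => [|k IHk].
  by rewrite add0n modn_small ?residue_lt.
by rewrite -[RHS]IHk [in RHS]residueE addSn modn_dvdm // dvdn_exp2l ?leq_addl.
Qed.

Lemma padic_int_of_subproof (F : nat -> nat) :
  (forall n, F n = F n.+1 %[mod p ^ n]) ->
  forall n, (F n %% p ^ n = (F n.+1 %% p ^ n.+1) %% p ^ n)%N.
Proof. by move=> FE n; rewrite FE modn_dvdm // dvdn_exp2l. Qed.

Definition padic_int_of F FE : Z_p :=
  PadicInt p_pr (@padic_int_of_subproof F FE).

Definition padic_int_const (k : nat) : Z_p :=
  @padic_int_of (fun=> k) (fun=> erefl).

Lemma residueE_mod x n : x n = x n.+1 %[mod p ^ n].
Proof. by rewrite {1}residueE modn_mod. Qed.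

Lemma padic_int_add_subproof x y n :
  (x n + y n)%N = (x n.+1 + y n.+1)%N %[mod p ^ n].
Proof. by rewrite -modnDm !(residueE_mod _ n) modnDm. Qed.
Definition padic_int_add x y : Z_p := padic_int_of (padic_int_add_subproof x y).

Lemma padic_int_mul_subproof x y n :
  (x n * y n)%N = (x n.+1 * y n.+1)%N %[mod p ^ n].
Proof. by rewrite -modnMm !(residueE_mod _ n) modnMm. Qed.
Definition padic_int_mul x y : Z_p := padic_int_of (padic_int_mul_subproof x y).

Lemma padic_int_opp_subproof x n :
  (p ^ n - x n)%N = (p ^ n.+1 - x n.+1)%N %[mod p ^ n].
Proof.
apply/eqP; rewrite -(eqn_modDr (x n.+1)) subnK ?(ltnW (residue_lt _ _)) //.
rewrite -modnDmr -residueE subnK ?(ltnW (residue_lt _ _)) //.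
by rewrite modnn expnS modnMl.
Qed.
Definition padic_int_opp x : Z_p := padic_int_of (padic_int_opp_subproof x).

Lemma padic_int_addA : associative padic_int_add.
Proof. by move=> x y z; apply: padic_intP => n /=; rewrite modnDml modnDmr addnA. Qed.

Lemma padic_int_addC : commutative padic_int_add.
Proof. by move=> x y; apply: padic_intP => n /=; rewrite addnC. Qed.

Lemma padic_int_add0 : left_id (padic_int_const 0) padic_int_add.
Proof.
by move=> x; apply: padic_intP => n /=; rewrite mod0n add0n modn_small ?residue_lt.
Qed.

Lemma padic_int_addN :
  left_inverse (padic_int_const 0) padic_int_opp padic_int_add.
Proof.
move=> x; apply: padic_intP => n /=.
by rewrite modnDml subnK ?(ltnW (residue_lt _ _)) // modnn mod0n.
Qed.

HB.instance Definition _ := GRing.isZmodule.Build Z_p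
  padic_int_addA padic_int_addC padic_int_add0 padic_int_addN.

Lemma padic_int_mulA : associative padic_int_mul.
Proof. by move=> x y z; apply: padic_intP => n /=; rewrite modnMml modnMmr mulnA. Qed.

Lemma padic_int_mulC : commutative padic_int_mul.
Proof. by move=> x y; apply: padic_intP => n /=; rewrite mulnC. Qed.

Lemma padic_int_mul1 : left_id (padic_int_const 1) padic_int_mul.
Proof.
by move=> x; apply: padic_intP => n /=; rewrite modnMml mul1n modn_small ?residue_lt.
Qed.

Lemma padic_int_mulDl : left_distributive padic_int_mul padic_int_add.
Proof.
move=> x y z; apply: padic_intP => n /=.
by rewrite modnMml modnDm mulnDl.
Qed.

Lemma padic_int_1neq0 : padic_int_const 1 != 0.
Proof.
apply/eqP => /(congr1 (fun x : Z_p => x 1%N)) /=.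
by rewrite expn1 modn_small ?prime_gt1 // mod0n.
Qed.

HB.instance Definition _ := GRing.Zmodule_isComNzRing.Build Z_p
  padic_int_mulA padic_int_mulC padic_int_mul1 padic_int_mulDl padic_int_1neq0.

Lemma residue0 n : (0 : Z_p) n = 0%N. Proof. exact: mod0n. Qed.
Lemma residue1 n : (1 : Z_p) n = (1 %% p ^ n)%N. Proof. by []. Qed.
Lemma residueD x y n : (x + y) n = ((x n + y n) %% p ^ n)%N. Proof. by []. Qed.
Lemma residueN x n : (- x) n = ((p ^ n - x n) %% p ^ n)%N. Proof. by []. Qed.
Lemma residueM x y n : (x * y) n = ((x n * y n) %% p ^ n)%N. Proof. by []. Qed.

Lemma residue_nat (k n : nat) : (k%:R : Z_p) n = (k %% p ^ n)%N.
Proof.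
elim: k => [|k IHk]; first by rewrite residue0 mod0n.
by rewrite -natr1 residueD IHk residue1 modnDm addn1.
Qed.

Definition padic_int_unit : pred Z_p := fun x => `[< exists y, y * x = 1 >].
Definition padic_int_inv x : Z_p :=
  if padic_int_unit x then xget 0 [set y | y * x = 1] else x.

Lemma padic_int_mulV :
  {in padic_int_unit, left_inverse 1 padic_int_inv *%R}.
Proof.
move=> x ux; rewrite /padic_int_inv ifT //.
case/asboolP: ux => y yx.
by apply: (@xgetPex _ 0 [set y | y * x = 1]); exists y.
Qed.

Lemma padic_int_unitP x y : y * x = 1 -> padic_int_unit x.
Proof. by move=> yx; apply/asboolP; exists y. Qed.

Lemma padic_int_inv_out : {in [predC padic_int_unit], padic_int_inv =1 id}.
Proof. by move=> x ux; rewrite /padic_int_inv ifN. Qed.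

HB.instance Definition _ := GRing.ComNzRing_hasMulInverse.Build Z_p
  padic_int_mulV padic_int_unitP padic_int_inv_out.

(* The p-adic valuation, with the junk value 0 at x = 0. *)
Definition padic_int_val x : nat := xget 0%N [set n | x n = 0%N /\ x n.+1 <> 0%N].

Lemma padic_int_valP x : x != 0 ->
  x (padic_int_val x) = 0%N /\ x (padic_int_val x).+1 <> 0%N.
Proof.
move=> x0; apply: (@xgetPex _ 0%N [set n | x n = 0%N /\ x n.+1 <> 0%N]) => /=.
have [n0 xn0] : exists n, x n != 0%N.
  apply: contrapT => h; move/eqP: x0; apply; apply: padic_intP => n.
  rewrite residue0; apply: contrapT => xn; apply: h; exists n.
  exact/eqP.
have xE : exists n, x n != 0%N by exists n0.
case: (ex_minnP xE) => -[|m] xm mmin.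
  by have := residue_lt x 0; rewrite expn0 ltnS leqn0 (negPf xm).
exists m; split; last exact/eqP.
by apply/eqP; apply: contraTT isT => /mmin; rewrite ltnn.
Qed.

Lemma residue_eq0 x n : x != 0 -> (x n == 0%N) = (n <= padic_int_val x)%N.
Proof.
move=> /padic_int_valP []; set v := padic_int_val x => xv xv1.
have [nv|vn] := leqP n v; first by rewrite -(residue_mod _ nv) xv mod0n eqxx.
apply/eqP => xn; apply: xv1.
by rewrite -(residue_mod _ vn) xn mod0n.
Qed.

Lemma logn_residue x n : x != 0 -> (padic_int_val x < n)%N ->
  x n != 0%N /\ logn p (x n) = padic_int_val x.
Proof.
move=> x0 vn; have xn : x n != 0%N by rewrite residue_eq0 // -ltnNge.
split=> //; have xn0 : (0 < x n)%N by rewrite lt0n.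
apply/eqP; rewrite eqn_leq; apply/andP; split.
  rewrite leqNgt -pfactor_dvdn // /dvdn residue_mod //.
  by rewrite residue_eq0 // ltnn.
rewrite -pfactor_dvdn // /dvdn residue_mod ?(ltnW vn) //.
by rewrite residue_eq0.
Qed.

Lemma padic_int_mul_neq0_val x y : x != 0 -> y != 0 ->
  x * y != 0 /\ padic_int_val (x * y) = (padic_int_val x + padic_int_val y)%N.
Proof.
move=> x0 y0; set a := padic_int_val x; set b := padic_int_val y; set N := (a + b).+2.
have aN : (a < N)%N by rewrite /N !ltnS (leq_trans (leq_addr b a)).
have bN : (b < N)%N by rewrite /N !ltnS (leq_trans (leq_addl a b)).
have vE n : (n < N)%N -> ((x * y) n == 0%N) = (n <= a + b)%N.
  move=> nN; rewrite -(residue_mod (x * y) (ltnW nN)) residueM.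
  have [xn lx] := logn_residue x0 aN; have [yn ly] := logn_residue y0 bN.
  rewrite modn_dvdm ?dvdn_exp2l ?(ltnW nN) //.
  rewrite -/(dvdn _ _) pfactor_dvdn // ?muln_gt0 ?lt0n ?xn ?yn //.
  by rewrite lognM ?lt0n // lx ly.
have xy0 : x * y != 0.
  by apply/eqP => xy; have := vE (a + b).+1 (ltnSn _); rewrite xy residue0 eqxx ltnn.
split=> //; apply/eqP; rewrite eqn_leq; apply/andP; split.
  rewrite leqNgt -residue_eq0 //.
  by rewrite vE // ltnn.
by rewrite -residue_eq0 // vE ?leqnn // /N ltnS leqnSn.
Qed.

Lemma padic_int_idomain x y : x * y = 0 -> (x == 0) || (y == 0).
Proof.
move=> xy; apply/norP => -[x0 y0].
by have [] := padic_int_mul_neq0_val x0 y0; rewrite xy eqxx.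
Qed.

HB.instance Definition _ :=
  GRing.ComUnitRing_isIntegral.Build Z_p padic_int_idomain.

Lemma residue_at0 x : x 0%N = 0%N.
Proof. by have := residue_lt x 0; rewrite expn0 ltnS leqn0 => /eqP. Qed.

Lemma residue_modp x n : (x n.+1 %% p)%N = x 1%N.
Proof. by have := residue_mod x (ltn0Sn n); rewrite expn1. Qed.

Lemma padic_int_shift_subproof x v n :
  (x (n + v) %/ p ^ v)%N = (x (n.+1 + v) %/ p ^ v)%N %[mod p ^ n].
Proof.
rewrite -(residue_mod x (_ : n + v <= n.+1 + v)%N) ?leq_add2r ?leqnSn //.
by rewrite expnD -modn_divl modn_mod.
Qed.
Definition padic_int_shift x v : Z_p :=
  padic_int_of (padic_int_shift_subproof x v).

Lemma padic_int_shiftK x v : x v = 0%N -> (p ^ v)%:R * padic_int_shift x v = x.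
Proof.
move=> xv; apply: padic_intP => n; rewrite residueM residue_nat /= modnMm.
have /divnK E : (p ^ v %| x (n + v))%N.
  by rewrite /dvdn residue_mod ?leq_addl // xv.
by rewrite mulnC E residue_mod ?leq_addr.
Qed.

Lemma residue_shift_neq0 x : x != 0 -> padic_int_shift x (padic_int_val x) 1 <> 0%N.
Proof.
move=> x0 h; have [xv] := padic_int_valP x0; apply; rewrite -{1}(padic_int_shiftK xv).
rewrite residueM residue_nat modnMml expnSr.
set s := padic_int_shift _ _ in h *.
have /dvdnP[k ->] : (p %| s (padic_int_val x).+1)%N.
  by rewrite /dvdn residue_modp h.
by rewrite [(k * p)%N]mulnC mulnA modnMr.
Qed.

Lemma padic_int_inv_subproof x : x 1%N <> 0%N -> forall n,
  (x n ^ (totient (p ^ n)).-1)%N = (x n.+1 ^ (totient (p ^ n.+1)).-1)%N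
    %[mod p ^ n].
Proof.
move=> x1 n; case: n => [|n]; first by rewrite expn0 !modn1.
have cop k : coprime (x k.+1) p.
  rewrite coprime_sym prime_coprime // /dvdn residue_modp.
  exact/eqP.
have inv k : (x k.+1 * x k.+1 ^ (totient (p ^ k.+1)).-1)%N = 1 %[mod p ^ k.+1].
  rewrite -expnS prednK ?totient_gt0 //.
  by rewrite Euler_exp_totient // coprimeXr.
set y := (x n.+1 ^ _)%N; set z := (x n.+2 ^ _)%N.
have xz : (x n.+1 * z)%N = 1 %[mod p ^ n.+1].
  rewrite -modnMml residueE_mod modnMml -(@modn_dvdm (p ^ n.+2) (_ * _)%N).
    by rewrite inv modn_dvdm // dvdn_exp2l.
  by rewrite dvdn_exp2l.
rewrite -[y]muln1 -modnMmr -xz modnMmr mulnCA mulnA -modnMml.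
by rewrite inv modnMml mul1n.
Qed.

Lemma padic_int_unitE x : x 1%N <> 0%N -> x \is a GRing.unit.
Proof.
move=> x1; apply/asboolP; exists (padic_int_of (padic_int_inv_subproof x1)).
apply: padic_intP => -[|n].
  by rewrite !residue_at0.
have cop : coprime (x n.+1) p.
  rewrite coprime_sym prime_coprime // /dvdn residue_modp.
  exact/eqP.
rewrite residueM residue1 /= modnMml mulnC -expnS prednK ?totient_gt0 //.
by rewrite Euler_exp_totient // coprimeXr.
Qed.

Definition padic_int_abs x : rat :=
  if x == 0 then 0 else p%:R ^- padic_int_val x.

Let p_gt1 : 1 < p%:R :> rat. Proof. by rewrite ltr1n prime_gt1. Qed.
Let p_rgt0 : 0 < p%:R :> rat. Proof. by rewrite ltr0n. Qed.

Lemma padic_int_abs_le x n : (padic_int_abs x <= p%:R ^- n) = (x n == 0%N).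
Proof.
rewrite /padic_int_abs; case: eqVneq => [->|x0].
  by rewrite residue0 eqxx invr_ge0 exprn_ge0 // ltW.
by rewrite residue_eq0 // lef_pV2 ?posrE ?exprn_gt0 // ler_eXn2l.
Qed.

Lemma padic_int_abs_ge0 x : 0 <= padic_int_abs x.
Proof. by rewrite /padic_int_abs; case: ifP; rewrite ?lexx // invr_ge0 exprn_ge0 ?ltW. Qed.

Lemma padic_int_abs_eq0 x : (padic_int_abs x == 0) = (x == 0).
Proof.
rewrite /padic_int_abs; case: (eqVneq x 0) => x0; rewrite ?eqxx //.
by rewrite invr_eq0 expf_eq0 gt_eqF ?andbF.
Qed.

Lemma padic_int_abs_le1 x : padic_int_abs x <= 1.
Proof.
have := padic_int_abs_le x 0; rewrite expr0 invr1 => ->.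
by have := residue_lt x 0; rewrite expn0 ltnS leqn0.
Qed.

Lemma padic_int_absM x y :
  padic_int_abs (x * y) = padic_int_abs x * padic_int_abs y.
Proof.
rewrite /padic_int_abs; case: (eqVneq x 0) => [->|x0]; first by rewrite !mul0r eqxx.
case: (eqVneq y 0) => [->|y0]; first by rewrite !mulr0 eqxx.
have [xy0 ->] := padic_int_mul_neq0_val x0 y0.
by rewrite (negPf xy0) exprD invfM.
Qed.

Lemma padic_int_absD x y :
  padic_int_abs (x + y) <= Num.max (padic_int_abs x) (padic_int_abs y).
Proof.
wlog xy : x y / padic_int_abs x <= padic_int_abs y.
  move=> wl; case: (leP (padic_int_abs x) (padic_int_abs y)) => [|/ltW] h.
    by have := wl _ _ h; rewrite (max_idPr h).
  by have := wl _ _ h; rewrite addrC (max_idPr h).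
rewrite (max_idPr xy); case: (eqVneq y 0) xy => [->|y0].
  have abs0 : padic_int_abs 0 = 0 by apply/eqP; rewrite padic_int_abs_eq0.
  rewrite abs0 => x_le0; have /eqP : padic_int_abs x == 0.
    by rewrite eq_le x_le0 padic_int_abs_ge0.
  by move/eqP; rewrite padic_int_abs_eq0 => /eqP ->; rewrite addr0 abs0.
rewrite (_ : padic_int_abs y = p%:R ^- padic_int_val y); last first.
  by rewrite /padic_int_abs (negPf y0).
rewrite !padic_int_abs_le residueD => /eqP ->.
by have [-> _] := padic_int_valP y0; rewrite mod0n.
Qed.

Lemma padic_int_abs1 : padic_int_abs 1 = 1.
Proof.
have /mulfI : padic_int_abs 1 != 0 by rewrite padic_int_abs_eq0 oner_eq0.
by apply; rewrite -padic_int_absM !mulr1.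
Qed.

Lemma padic_int_absN x : padic_int_abs (- x) = padic_int_abs x.
Proof.
suff N1 : padic_int_abs (- 1) = 1 by rewrite -mulN1r padic_int_absM N1 mul1r.
have : padic_int_abs (- 1) ^+ 2 == 1 by rewrite expr2 -padic_int_absM mulrNN mulr1 padic_int_abs1.
rewrite sqrf_eq1 => /orP[/eqP //|/eqP h].
by have := padic_int_abs_ge0 (- 1); rewrite h oppr_ge0 ler10.
Qed.

End PadicIntRing.

(* Q_p is the fraction field of Z_p. *)
Definition padic (p : nat) (p_pr : prime p) := {fraction padic_int p_pr}.
HB.instance Definition _ p (p_pr : prime p) := GRing.Field.on (padic p_pr).

Section PadicField.
Variables (p : nat) (p_pr : prime p).
Local Notation Z_p := (padic_int p_pr).
Local Notation Q_p := (padic p_pr).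
Implicit Types x y z : Q_p.

Definition padic_of_int : Z_p -> Q_p := @FracField.tofrac _.
HB.instance Definition _ := GRing.RMorphism.on padic_of_int.

(* |a / b| = |a| / |b|, computed on a representative of the fraction;
   see [padic_abs_frac] for the independence of the representative. *)
Definition padic_abs x : rat :=
  padic_int_abs (frac (repr x)).1 / padic_int_abs (frac (repr x)).2.

Lemma padic_of_int_eq0 (a : Z_p) : (padic_of_int a == 0) = (a == 0).
Proof. exact: tofrac_eq0. Qed.

Lemma padic_fracE x :
  x = padic_of_int (frac (repr x)).1 / padic_of_int (frac (repr x)).2.
Proof.
have d0 := denom_ratioP (repr x).
apply/(canRL (mulfK _)); first by rewrite padic_of_int_eq0.
rewrite -{1}[x]reprK /padic_of_int; unlock FracField.tofrac.
rewrite -[LHS]FracField.pi_mul; apply/eqmodP; rewrite /= FracField.equivfE.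
by rewrite /FracField.mulf !numden_Ratio ?oner_eq0 ?mulr1 // mulrC.
Qed.

Lemma padic_abs_frac (a b : Z_p) : b != 0 ->
  padic_abs (padic_of_int a / padic_of_int b) = padic_int_abs a / padic_int_abs b.
Proof.
move=> b0; rewrite /padic_abs; set r := repr _.
have d0 := denom_ratioP r.
have /eqP := padic_fracE (padic_of_int a / padic_of_int b); rewrite -/r.
rewrite eqr_div ?padic_of_int_eq0 // -!rmorphM /= tofrac_eq => /eqP /(congr1 (@padic_int_abs _ _)).
rewrite !padic_int_absM => h; apply/eqP.
by rewrite eqr_div ?padic_int_abs_eq0 // h mulrC.
Qed.

Lemma padic_abs_of_int (a : Z_p) : padic_abs (padic_of_int a) = padic_int_abs a.
Proof.
have := @padic_abs_frac a 1 (oner_neq0 _).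
by rewrite rmorph1 padic_int_abs1 !divr1.
Qed.

Lemma padic_absM x y : padic_abs (x * y) = padic_abs x * padic_abs y.
Proof.
rewrite {1}(padic_fracE x) {1}(padic_fracE y) mulf_div -!rmorphM.
rewrite padic_abs_frac ?mulf_neq0 ?denom_ratioP //.
by rewrite !padic_int_absM -mulf_div.
Qed.

Lemma padic_abs_ge0 x : 0 <= padic_abs x.
Proof. by rewrite divr_ge0 ?padic_int_abs_ge0. Qed.

Lemma padic_abs_eq0 x : (padic_abs x == 0) = (x == 0).
Proof.
rewrite [in RHS](padic_fracE x) /padic_abs !mulf_eq0 !invr_eq0.
by rewrite !padic_int_abs_eq0 !padic_of_int_eq0.
Qed.

Lemma padic_abs0 : padic_abs 0 = 0.
Proof. by apply/eqP; rewrite padic_abs_eq0. Qed.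

Lemma padic_abs1 : padic_abs 1 = 1.
Proof. by rewrite -[1](rmorph1 padic_of_int) padic_abs_of_int padic_int_abs1. Qed.

Lemma padic_absN x : padic_abs (- x) = padic_abs x.
Proof.
by rewrite -mulN1r padic_absM -(rmorphN1 padic_of_int) padic_abs_of_int
  padic_int_absN padic_int_abs1 mul1r.
Qed.

Lemma padic_absD x y : padic_abs (x + y) <= Num.max (padic_abs x) (padic_abs y).
Proof.
set a := (frac (repr x)).1; set b := (frac (repr x)).2.
set c := (frac (repr y)).1; set d := (frac (repr y)).2.
have b0 : b != 0 by exact: denom_ratioP.
have d0 : d != 0 by exact: denom_ratioP.
have gt0 u : u != 0 -> 0 < padic_int_abs u.
  by move=> u0; rewrite lt_neqAle padic_int_abs_ge0 eq_sym padic_int_abs_eq0 u0.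
rewrite {1}(padic_fracE x) {1}(padic_fracE y) -/a -/b -/c -/d.
rewrite addf_div ?padic_of_int_eq0 // -!rmorphM -rmorphD padic_abs_frac ?mulf_neq0 //.
rewrite padic_int_absM ler_pdivrMr ?mulr_gt0 ?gt0 //.
apply: le_trans (padic_int_absD _ _) _.
rewrite maxr_pMl ?mulr_ge0 ?padic_int_abs_ge0 // !padic_int_absM /padic_abs -/a -/b -/c -/d.
rewrite mulrA divfK ?padic_int_abs_eq0 //.
by rewrite [padic_int_abs b * _]mulrC mulrA divfK ?padic_int_abs_eq0.
Qed.

Lemma padic_abs_sum (I : Type) (r : seq I) (P : pred I) (F : I -> Q_p) (e : rat) :
  0 <= e -> (forall i, P i -> padic_abs (F i) <= e) ->
  padic_abs (\sum_(i <- r | P i) F i) <= e.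
Proof.
move=> e0 Fe; apply: (big_ind (fun x => padic_abs x <= e)) => //.
  by rewrite padic_abs0.
by move=> x y xe ye; apply: le_trans (padic_absD _ _) _; rewrite ge_max xe.
Qed.

Lemma padic_abs_nat_le1 (k : nat) : padic_abs k%:R <= 1.
Proof. by rewrite -(rmorph_nat padic_of_int) padic_abs_of_int padic_int_abs_le1. Qed.

Lemma padic_absX x n : padic_abs (x ^+ n) = padic_abs x ^+ n.
Proof. by elim: n => [|n IHn]; rewrite ?padic_abs1 // !exprS padic_absM IHn. Qed.

Lemma padic_abs_prime : padic_abs p%:R = p%:R^-1.
Proof.
rewrite -(rmorph_nat padic_of_int) padic_abs_of_int; apply/eqP.
have pp := prime_gt1 p_pr.
rewrite -[p%:R^-1]/(p%:R ^- 1) eq_le padic_int_abs_le residue_nat expn1 modnn eqxx /=.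
rewrite leNgt; apply/negP => h.
have pN0 : (p%:R : Z_p) != 0.
  apply/eqP => /(congr1 (fun u : Z_p => u 2)); rewrite residue_nat residue0.
  by rewrite modn_small ?ltn_Pmulr ?expnS ?expn1; lia.
move: h; rewrite /padic_int_abs (negPf pN0) ltf_pV2 ?posrE ?exprn_gt0 ?ltr0n ?(ltnW pp) //.
rewrite ltr_eXn2l ?ltr1n // -residue_eq0 // residue_nat.
by rewrite modn_small ?expnS ?expn1; nia.
Qed.

Definition padic_dist x y : rat := padic_abs (x - y).

Lemma padic_distxx x : padic_dist x x = 0.
Proof. by rewrite /padic_dist subrr padic_abs0. Qed.

Lemma padic_dist_eq0 x y : padic_dist x y = 0 -> x = y.
Proof. by move/eqP; rewrite padic_abs_eq0 subr_eq0 => /eqP. Qed.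

Lemma padic_dist_sym x y : padic_dist x y = padic_dist y x.
Proof. by rewrite /padic_dist -padic_absN opprB. Qed.

Lemma padic_dist_triangle y x z :
  padic_dist x z <= padic_dist x y + padic_dist y z.
Proof.
rewrite /padic_dist -(subrKA y); apply: le_trans (padic_absD _ _) _.
by rewrite ge_max lerDl lerDr !padic_abs_ge0.
Qed.

HB.instance Definition _ := isMetric.Build rat Q_p
  padic_distxx padic_dist_eq0 padic_dist_sym padic_dist_triangle.
HB.instance Definition _ := isPointed.Build Q_p 0.

(* Z_p as a subset of Q_p. *)
Definition padic_integers : set Q_p := [set x | padic_abs x <= 1].

Lemma padic_integersE : padic_integers = range padic_of_int.
Proof.
apply/seteqP; split => [x x1|_ [a _ <-]]; last first.
  by rewrite /padic_integers /= padic_abs_of_int padic_int_abs_le1.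
rewrite [x]padic_fracE; set a := (frac (repr x)).1; set b := (frac (repr x)).2.
have b0 : b != 0 by exact: denom_ratioP.
have := x1; rewrite /padic_integers /= /padic_abs -/a -/b.
rewrite ler_pdivrMr ?mul1r; last first.
  by rewrite lt_neqAle padic_int_abs_ge0 eq_sym padic_int_abs_eq0 b0.
rewrite [X in _ <= X](_ : _ = p%:R ^- padic_int_val b); last first.
  by rewrite /padic_int_abs (negPf b0).
rewrite padic_int_abs_le => /eqP av; have [bv _] := padic_int_valP b0.
set v := padic_int_val b in av bv.
have ub := padic_int_unitE (residue_shift_neq0 b0).
exists (padic_int_shift a v * (padic_int_shift b v)^-1) => //.
apply/(canRL (mulfK _)); first by rewrite padic_of_int_eq0.
rewrite -rmorphM /= -{2}(padic_int_shiftK bv) mulrCA mulrVK //.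
by rewrite padic_int_shiftK.
Qed.

(* Elements of Z_p{x}, given by their coefficients. *)
Record restricted_series := RestrictedSeries {
  coef_series :> nat -> Q_p ;
  coef_series_int : forall i, padic_integers (coef_series i) ;
  coef_series_cvg0 :
    (fun i => padic_abs (coef_series i) : rat^o) @ \oo --> (0 : rat^o)
}.

Definition padic_borel := g_sigma_algebraType (@open Q_p).

End PadicField.

Section RestrictedSeries.
Variables (p : nat) (p_pr : prime p).
Local Notation Z_p := (padic_int p_pr).
Local Notation Q_p := (padic p_pr).
Local Notation "Z_p{x}" := (restricted_series p_pr).
Implicit Types (g h : Z_p{x}) (x : Q_p).

Lemma padic_abs_cvg0P (u : nat -> Q_p) :
  (fun i => padic_abs (u i) : rat^o) @ \oo --> (0 : rat^o) <->
  forall e : rat, 0 < e ->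
    exists N, forall i, (N <= i)%N -> padic_abs (u i) < e.
Proof.
split=> [/cvgrPdist_lt uP e e0|uP].
  have [N _ NP] := uP _ e0; exists N => i Ni.
  by have := NP i Ni; rewrite sub0r normrN ger0_norm ?padic_abs_ge0.
apply/cvgrPdist_lt => e e0; have [N NP] := uP _ e0.
by exists N => // i /= Ni; rewrite sub0r normrN ger0_norm ?padic_abs_ge0 ?NP.
Qed.

Lemma poly_series_int (q : {poly Z_p}) i :
  padic_integers (padic_of_int (q`_i)).
Proof. by rewrite /padic_integers /= padic_abs_of_int padic_int_abs_le1. Qed.

Lemma poly_series_cvg0 (q : {poly Z_p}) :
  (fun i => padic_abs (padic_of_int (q`_i)) : rat^o) @ \oo --> (0 : rat^o).
Proof.
apply/(padic_abs_cvg0P (fun i => padic_of_int (q`_i))) => e e0.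
by exists (size q) => i qi; rewrite nth_default // rmorph0 padic_abs0.
Qed.

(* The inclusion of Z_p[x] in Z_p{x}. *)
Definition poly_series (q : {poly Z_p}) : Z_p{x} :=
  RestrictedSeries (poly_series_int q) (@poly_series_cvg0 q).

Lemma mul_series_int g h n :
  padic_integers (\sum_(i < n.+1) g i * h (n - i)%N).
Proof.
apply: padic_abs_sum => // i _; rewrite padic_absM.
by rewrite mulr_ile1 ?padic_abs_ge0 // coef_series_int.
Qed.

Lemma mul_series_cvg0 g h :
  (fun n => padic_abs (\sum_(i < n.+1) g i * h (n - i)%N) : rat^o) @ \oo
    --> (0 : rat^o).
Proof.
apply/(padic_abs_cvg0P (fun n => \sum_(i < n.+1) g i * h (n - i)%N)) => e e0.
have e20 : 0 < e / 2 by rewrite divr_gt0.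
have [M MP] := (padic_abs_cvg0P g).1 (@coef_series_cvg0 _ _ g) _ e20.
have [N NP] := (padic_abs_cvg0P h).1 (@coef_series_cvg0 _ _ h) _ e20.
exists (M + N)%N => n MNn; apply: (@le_lt_trans _ _ (e / 2)); last by lra.
apply: padic_abs_sum => [|i _]; first exact: ltW.
have g1 := coef_series_int g i; have h1 := coef_series_int h (n - i).
rewrite /padic_integers /= in g1 h1; rewrite padic_absM.
have [Mi|iM] := leqP M i.
  by apply: le_trans (ltW (MP _ Mi)); rewrite ler_piMr ?padic_abs_ge0.
have Ni : (N <= n - i)%N by lia.
by apply: le_trans (ltW (NP _ Ni)); rewrite ler_piMl ?padic_abs_ge0.
Qed.

Definition mul_series g h : Z_p{x} :=
  RestrictedSeries (mul_series_int g h) (@mul_series_cvg0 g h).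

Lemma geometric_series_int i : padic_integers (p%:R ^+ i : Q_p).
Proof. by rewrite /padic_integers /= -natrX padic_abs_nat_le1. Qed.

Lemma geometric_series_cvg0 :
  (fun i => padic_abs (p%:R ^+ i : Q_p) : rat^o) @ \oo --> (0 : rat^o).
Proof.
apply/(padic_abs_cvg0P (fun i => p%:R ^+ i : Q_p)) => e e0.
have pp := prime_gt1 p_pr.
exists (Num.truncn e^-1) => i ei.
rewrite padic_absX padic_abs_prime exprVn -[ltRHS]invrK.
rewrite ltf_pV2 ?posrE ?invr_gt0 ?exprn_gt0 ?ltr0n ?(ltnW pp) //.
apply: lt_le_trans (truncnS_gt _) _; rewrite -natrX ler_nat.
by apply: leq_ltn_trans ei _; exact: ltn_expl.
Qed.

(* The series sum_i p^i x^i. *)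
Definition geometric_series : Z_p{x} :=
  RestrictedSeries geometric_series_int geometric_series_cvg0.

Lemma truncate_series_int g d i :
  padic_integers (if (i <= d)%N then g i else 0).
Proof.
case: ifP => _; first exact: coef_series_int.
by rewrite /padic_integers /= padic_abs0.
Qed.

Lemma truncate_series_cvg0 g d :
  (fun i => padic_abs (if (i <= d)%N then g i else 0) : rat^o) @ \oo
    --> (0 : rat^o).
Proof.
apply/(padic_abs_cvg0P (fun i => if (i <= d)%N then g i else 0)) => e e0.
by exists d.+1 => i; rewrite ltnNge => /negPf ->; rewrite padic_abs0.
Qed.

(* The terms of degree at most d. *)
Definition truncate_series g d : Z_p{x} :=
  RestrictedSeries (truncate_series_int g d) (@truncate_series_cvg0 g d).

Definition series_eval g x : Q_p :=
  lim ((fun n => \sum_(0 <= i < n) g i * x ^+ i) @ \oo).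

End RestrictedSeries.

Section IgusaZeta.
Variables (R : realType) (p : nat) (p_pr : prime p).
Local Notation Q_p := (padic p_pr).
Local Notation "Z_p{x}" := (restricted_series p_pr).
Variable mu : {measure set (padic_borel p_pr) -> \bar R}.

(* mu is the Haar measure of the additive group Q_p with mu(Z_p) = 1.
   Regularity is automatic, as Q_p is locally compact and second countable. *)
Record normalized_haar : Prop := NormalizedHaar {
  haar_compact : forall K : set Q_p, compact K -> (mu K < +oo)%E ;
  haar_translation : forall (a : Q_p) (A : set (padic_borel p_pr)),
    measurable A -> mu [set a + x | x in A] = mu A ;
  haar_integers : mu (@padic_integers p p_pr) = 1%E
}.

(* a^s = exp (s ln a) for a > 0, and 0^s = 0. *)
Definition cpow (a : R) (s : R[i]) : R[i] :=
  if a == 0 then 0 else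
  let r := expR (complex.Re s * ln a) in
  let t := complex.Im s * ln a in
  Complex (r * cos t) (r * sin t).

Definition igusa_integrand (g : Z_p{x}) (s : R[i]) (x : Q_p) : R[i] :=
  cpow (ratr (padic_abs (series_eval g x))) s.

(* The integral of a complex function is taken componentwise. *)
Definition igusa_zeta (g : Z_p{x}) (s : R[i]) : R[i] :=
  Complex
    (\int[mu]_(x in @padic_integers p p_pr) complex.Re (igusa_integrand g s x))
    (\int[mu]_(x in @padic_integers p p_pr) complex.Im (igusa_integrand g s x)).

Definition igusa_zeta_eq (g h : Z_p{x}) : Prop :=
  forall s : R[i], 0 < complex.Re s -> igusa_zeta g s = igusa_zeta h s.

End IgusaZeta.

Definition f_series (p : nat) (p_pr : prime p) : restricted_series p_pr :=
  mul_series (poly_series (('X - 1) ^+ 2)) (geometric_series p_pr).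

(* Main.v *)
Require Import Defs.
From HB Require Import structures.
From mathcomp Require Import all_boot all_order all_algebra.
From mathcomp Require Import all_classical all_reals all_analysis.
From mathcomp Require Import measurable_realfun complex.
From mathcomp Require Import zify ring lra.
Set Implicit Arguments.
Unset Strict Implicit.
Unset Printing Implicit Defensive.
Import Order.TTheory GRing.Theory Num.Theory.
Import numFieldNormedType.Exports.
Local Open Scope classical_set_scope.
Local Open Scope ring_scope.

(** On Z_p the denominator of f(x) = (x - 1)^2 / (1 - p x) is a unit, so
    |f(x)| = |x - 1|^2 ([padic_abs_f]).  For k >= 2 the coefficient of x^k in f
    is (p - 1)^2 p^(k-2), so summing the geometric tail gives
      (1 - p x) f_{d+1}(x) = (x - 1)^2 - (p - 1)^2 p^d x^(d+2)
    ([f_series_partial_sum]).  Let d = 2D - 1.  If x is a unit, the first term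
    on the right is 0 or has even valuation, while the second has the odd
    valuation d: no cancellation can occur.  If |x| < 1, the first term is a
    unit and the second is not.  In both cases
      |f_{2D}(x)| = max(|x - 1|^2, p^-(2D-1))
    ([padic_abs_truncate_f]).  Hence |f| <= |f_{2D}| everywhere on Z_p, with a
    gap of at least p^-(2D-1) - p^-2D on the ball |x - 1| <= p^-D.  This ball
    has positive Haar measure because p^D of its translates cover Z_p
    ([haar_closed_ball_gt0]), so the two zeta functions already differ at
    s = 1, where they are the integrals of |f_{2D}| and |f|
    ([igusa_zeta_truncate_neq]).  As 2D is arbitrarily large, the truncations
    never stabilize to Z_f. *)

(** * The p-adic absolute value *)

Section PadicAbs.
Variables (p : nat) (p_pr : prime p).
Local Notation Q_p := (padic p_pr).
Implicit Types x y : Q_p.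

Lemma padic_absB x y : padic_abs (x - y) <= Num.max (padic_abs x) (padic_abs y).
Proof. by rewrite -(padic_absN y) padic_absD. Qed.

Lemma padic_absD_lt x y : padic_abs x < padic_abs y ->
  padic_abs (x + y) = padic_abs y.
Proof.
move=> xy; apply/eqP; rewrite eq_le; apply/andP; split.
  by apply: le_trans (padic_absD _ _) _; rewrite ge_max lexx ltW.
have := padic_absB (x + y) x; rewrite [x + y]addrC addrK le_max => /orP[//|].
by move=> /(lt_le_trans xy); rewrite ltxx.
Qed.

(** Two terms can cancel only if they have the same absolute value; this
    gives |f_{2D}| exactly instead of an upper bound. *)
Lemma padic_absB_neq x y : padic_abs x != padic_abs y ->
  padic_abs (x - y) = Num.max (padic_abs x) (padic_abs y).
Proof.
rewrite neq_lt => /orP[xy|yx].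
  by rewrite -(padic_absN y) padic_absD_lt ?padic_absN // (max_idPr (ltW xy)).
by rewrite addrC padic_absD_lt ?padic_absN // (max_idPl (ltW yx)).
Qed.

Lemma padic_absM_unit x u : padic_abs u = 1 -> padic_abs (x * u) = padic_abs x.
Proof. by rewrite padic_absM => ->; rewrite mulr1. Qed.

Lemma padic_abs_prime_lt1 : padic_abs (p%:R : Q_p) < 1.
Proof. by rewrite padic_abs_prime invf_lt1 ?ltr0n ?ltr1n ?prime_gt0 ?prime_gt1. Qed.

Lemma padic_abs1B x : padic_abs x < 1 -> padic_abs (1 - x) = 1.
Proof.
move=> x1; rewrite padic_absB_neq padic_abs1 ?(gt_eqF x1) //.
exact/max_idPl/ltW.
Qed.

Lemma padic_abs_pB1 : padic_abs (p%:R - 1 : Q_p) = 1.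
Proof. by rewrite -padic_absN opprB padic_abs1B // padic_abs_prime_lt1. Qed.

Lemma padic_abs_int_exp x : padic_integers x -> x != 0 ->
  exists n, padic_abs x = p%:R ^- n.
Proof.
rewrite padic_integersE => -[a _ <-] a0; rewrite padic_abs_of_int.
exists (padic_int_val a); rewrite /padic_int_abs ifN //.
by rewrite -padic_of_int_eq0.
Qed.

(** The truncation i of x modulo p^k is within p^-k of x: Z_p is covered by
    p^k balls of radius p^-k. *)
Lemma padic_integers_cover x k : padic_integers x ->
  exists2 i, (i < p ^ k)%N & padic_abs (x - i%:R) <= p%:R ^- k.
Proof.
rewrite padic_integersE => -[a _ <-]; exists (a k); first exact: residue_lt.
rewrite -(rmorph_nat (@padic_of_int p p_pr)) -rmorphB padic_abs_of_int.
rewrite padic_int_abs_le residueD residueN residue_nat modnDmr.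
rewrite (modn_small (residue_lt a k)) subnKC ?modnn //.
exact/ltnW/residue_lt.
Qed.

End PadicAbs.

(** * Values of f and of its truncations on Z_p *)

Section Evaluation.
Variables (p : nat) (p_pr : prime p).
Local Notation Q_p := (padic p_pr).
Local Notation f := (f_series p_pr).
Implicit Types (x : Q_p) (d D : nat).

Lemma f_series_coef : [/\ f 0%N = 1, f 1%N = p%:R - 2%:R
  & forall i, f i.+2 = (p%:R - 1) ^+ 2 * p%:R ^+ i].
Proof.
(* Only the coefficients 1, -2, 1 of (X - 1)^2 contribute to the Cauchy
   product. *)
have q i : (('X - 1) ^+ 2 : {poly padic_int p_pr})`_i =
    (i == 2)%:R - (i == 1)%:R *+ 2 + (i == 0)%:R.
  by rewrite sqrrB1 coefD coefB coefXn coefMn coefX coef1.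
split=> [||i]; rewrite /f_series /=.
- by rewrite big_ord1 q /= mul0rn subr0 add0r rmorph1 mul1r.
- rewrite big_ord_recl big_ord1 /= !q /=.
  rewrite mul0rn subr0 add0r rmorph1 mul1r sub0r addr0 rmorphN rmorphMn rmorph1.
  by rewrite expr1 expr0 mulr1.
- rewrite 3!big_ord_recl big1 => [|j _]; last first.
    by rewrite q /= mul0rn subr0 addr0 rmorph0 mul0r.
  rewrite /= !q /= /bump /= !mul0rn !subr0 !sub0r !addr0 !add0r.
  rewrite rmorphN rmorphMn !rmorph1.
  by rewrite subn0 subn1 subn2 /= !exprS; ring.
Qed.

(** Multiplying by 1 - p x telescopes the geometric part of f, so that every
    truncation of positive degree becomes (x - 1)^2 minus a single monomial. *)
Lemma f_series_partial_sum d x :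
  (\sum_(0 <= i < d.+2) f i * x ^+ i) * (1 - p%:R * x) =
  (x - 1) ^+ 2 - (p%:R - 1) ^+ 2 * p%:R ^+ d * x ^+ d.+2.
Proof.
have [] := f_series_coef; move: (coef_series f) => u u0 u1 uS.
elim: d => [|d IHd]; first by rewrite !big_nat_recr //= big_nil u0 u1; ring.
by rewrite big_nat_recr //= mulrDl IHd uS !exprS; ring.
Qed.

Lemma series_eval_truncate (g : restricted_series p_pr) d x :
  series_eval (truncate_series g d) x = \sum_(0 <= i < d.+1) g i * x ^+ i.
Proof.
apply: cvg_lim; first exact: metric_hausdorff.
apply: cvg_near_cst; exists d.+1 => //= n dn.
rewrite (big_cat_nat (n := d.+1)) //= [X in _ + X]big_nat_cond [X in _ + X]big1 ?addr0.
  by apply: eq_big_nat => i /andP[_]; rewrite ltnS => ->.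
by move=> i /andP[/andP[di _] _]; rewrite leqNgt di mul0r.
Qed.

Lemma f_series_denominator x : padic_integers x ->
  padic_abs (1 - p%:R * x) = 1.
Proof.
move=> x1; apply: padic_abs1B; rewrite padic_absM.
apply: le_lt_trans (padic_abs_prime_lt1 p_pr).
by rewrite ler_piMr ?padic_abs_ge0.
Qed.

Lemma series_eval_f x : padic_integers x ->
  series_eval f x = (x - 1) ^+ 2 / (1 - p%:R * x).
Proof.
move=> x1; have den := f_series_denominator x1.
have den0 : 1 - p%:R * x != 0 by rewrite -padic_abs_eq0 den oner_eq0.
apply: cvg_lim; first exact: metric_hausdorff.
apply/cvg_ballP => e e0.
(* The distance from the partial sum to the limit is
   |(p - 1)^2 p^n x^(n+2)| <= |p^n|. *)
have [N NP] := (padic_abs_cvg0P _).1 (@geometric_series_cvg0 p p_pr) _ e0.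
exists N.+2 => //= -[|[|n]] //= Nn.
rewrite ballEmdist /=; apply: le_lt_trans (NP n _); last by [].
set S := \sum_(_ <= _ < _) _.
have -> : S = ((x - 1) ^+ 2 - (p%:R - 1) ^+ 2 * p%:R ^+ n * x ^+ n.+2) / (1 - p%:R * x).
  by rewrite -f_series_partial_sum mulfK.
rewrite /mdist /= /padic_dist -mulrBl opprB addrC subrK.
rewrite -(padic_absM_unit _ den) divfK // mulrAC padic_absM.
rewrite ler_piMl ?padic_abs_ge0 // padic_absM !padic_absX padic_abs_pB1 expr1n mul1r.
by rewrite exprn_ile1 ?padic_abs_ge0.
Qed.

Lemma padic_abs_f x : padic_integers x ->
  padic_abs (series_eval f x) = padic_abs (x - 1) ^+ 2.
Proof.
move=> x1; have den := f_series_denominator x1.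
have den0 : 1 - p%:R * x != 0 by rewrite -padic_abs_eq0 den oner_eq0.
by rewrite series_eval_f // -(padic_absM_unit _ den) divfK // padic_absX.
Qed.

(** The terms (x - 1)^2 and (p - 1)^2 p^(2D-1) x^(2D+1) never have the same
    absolute value: for a unit x the valuation of the former is even (or
    infinite) and that of the latter is 2D - 1; otherwise the former is a unit
    and the latter is not. *)
Lemma padic_abs_truncate_f D x : (0 < D)%N -> padic_integers x ->
  padic_abs (series_eval (truncate_series f (2 * D)) x) =
  Num.max (padic_abs (x - 1) ^+ 2) (p%:R ^- (2 * D).-1).
Proof.
move=> D0 x1; have den := f_series_denominator x1.
have [d Dd] : exists d, (2 * D)%N = d.+1 by exists (2 * D).-1; rewrite prednK ?muln_gt0.
rewrite Dd /= series_eval_truncate -(padic_absM_unit _ den) f_series_partial_sum.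
set A := (x - 1) ^+ 2; set B := _ * x ^+ d.+2.
have AE : padic_abs A = padic_abs (x - 1) ^+ 2 by rewrite padic_absX.
have BE : padic_abs B = p%:R ^- d * padic_abs x ^+ d.+2.
  rewrite padic_absM (padic_absX x) padic_absM !padic_absX padic_abs_pB1.
  by rewrite padic_abs_prime expr1n mul1r exprVn.
have p0 : 0 < p%:R :> rat by rewrite ltr0n prime_gt0.
have p1 : 1 < p%:R :> rat by rewrite ltr1n prime_gt1.
have pd1 : p%:R ^- d <= 1 :> rat by rewrite invf_le1 ?exprn_gt0 // exprn_ege1 // ltW.
have [xu|xlt] : padic_abs x = 1 \/ padic_abs x < 1.
  by move: x1; rewrite /padic_integers /= le_eqVlt => /orP[/eqP|]; [left|right].
- move: BE; rewrite xu expr1n mulr1 => BE.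
  rewrite padic_absB_neq ?AE ?BE //.
  have [->|x10] := eqVneq (x - 1) 0.
    by rewrite padic_abs0 expr0n /= eq_sym gt_eqF // invr_gt0 exprn_gt0.
  have [|n ->] := padic_abs_int_exp _ x10.
    by apply: le_trans (padic_absB _ _) _; rewrite ge_max padic_abs1 x1 lexx.
  rewrite -!exprVn -exprM; apply/eqP.
  have pV0 : 0 < p%:R^-1 :> rat by rewrite invr_gt0.
  have pV1 : p%:R^-1 != 1 :> rat by rewrite invr_eq1 gt_eqF.
  by move=> /(ieexprIn pV0 pV1); lia.
- have x11 : padic_abs (x - 1) = 1 by rewrite -padic_absN opprB padic_abs1B.
  rewrite x11 expr1n (max_idPl pd1).
  suff B1 : padic_abs B < padic_abs A.
    by rewrite padic_absB_neq ?gt_eqF // (max_idPl (ltW B1)) AE x11 expr1n.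
  rewrite AE x11 expr1n BE; apply: (@le_lt_trans _ _ (padic_abs x ^+ d.+2)).
    by rewrite ler_piMl ?exprn_ge0 ?padic_abs_ge0.
  by rewrite exprn_ilt1 ?padic_abs_ge0.
Qed.

End Evaluation.

(** * Measurability and Haar measure of balls *)

Section PadicMeasurability.
Variables (R : realType) (p : nat) (p_pr : prime p).
Local Notation Q_p := (padic p_pr).
Local Notation Z_p := (@padic_integers p p_pr : set (padic_borel p_pr)).
Implicit Types (x a : Q_p) (k : nat).

(** If |x - a| > 0, then |y - a| = |x - a| for every y closer to x than a:
    y |-> |y - a| is locally constant away from a. *)
Lemma open_padic_abs_ge a (c : R) : 0 < c ->
  open [set x | c <= ratr (padic_abs (x - a))].
Proof.
move=> c0; rewrite openE => x /= cx; apply/nbhs_ballP.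
have x0 : 0 < padic_abs (x - a).
  by rewrite -(ltr0q R) (lt_le_trans c0).
exists (padic_abs (x - a)) => //= y; rewrite ballEmdist /= /mdist /= padic_dist_sym => yx.
by rewrite -[y](subrK x) -addrA padic_absD_lt.
Qed.

Lemma measurable_padic_abs a :
  measurable_fun setT (fun x : padic_borel p_pr => ratr (padic_abs (x - a)) : R).
Proof.
apply: (measurability (@RGenCInfty.G R)) => [|/= _ [_] [c] -> <-].
  exact: RGenCInfty.measurableE.
rewrite setTI; have [c0|c0] := leP c 0.
  rewrite (_ : _ @^-1` _ = setT) //; apply/seteqP; split=> // x _ /=.
  by rewrite in_itv /= andbT (le_trans c0) // ler0q padic_abs_ge0.
rewrite (_ : _ @^-1` _ = [set x : Q_p | c <= ratr (padic_abs (x - a))]).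
  by apply: sub_sigma_algebra; exact: open_padic_abs_ge.
by apply/seteqP; split=> x /=; rewrite in_itv /= andbT.
Qed.

Definition padic_closed_ball a k : set (padic_borel p_pr) :=
  [set x | padic_abs (x - a) <= p%:R ^- k].

Lemma padic_integers_ball : Z_p = padic_closed_ball 0 0.
Proof.
apply/seteqP; split=> x;
  by rewrite /padic_integers /padic_closed_ball /= subr0 expr0 invr1.
Qed.

Lemma measurable_padic_closed_ball a k : measurable (padic_closed_ball a k).
Proof.
have := measurable_padic_abs a measurableT (measurable_itv `]-oo, ratr (p%:R ^- k)]).
rewrite setTI; congr measurable; apply/seteqP; split=> x /=;
  by rewrite in_itv /= ler_rat.
Qed.

Lemma measurable_padic_integers : measurable Z_p.
Proof. by rewrite padic_integers_ball; exact: measurable_padic_closed_ball. Qed.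

Variable mu : {measure set (padic_borel p_pr) -> \bar R}.
Hypothesis mu_haar : normalized_haar mu.

Lemma haar_closed_ball_center a k :
  mu (padic_closed_ball a k) = mu (padic_closed_ball 0 k).
Proof.
rewrite -(haar_translation mu_haar a (measurable_padic_closed_ball 0 k)).
congr (mu _); apply/seteqP; split=> [x xB|_ [x xB <-]] /=.
  by exists (x - a); [rewrite /padic_closed_ball /= subr0|rewrite addrC subrK].
by move: xB; rewrite /padic_closed_ball /= subr0 [a + x]addrC addrK.
Qed.

(** If a ball of radius p^-k were null, so would be its p^k translates that
    cover Z_p, against mu(Z_p) = 1. *)
Lemma haar_closed_ball_gt0 a k : (0 < mu (padic_closed_ball a k))%E.
Proof.
rewrite haar_closed_ball_center lt0e measure_ge0 andbT; apply/eqP => B0.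
have : (mu Z_p <= \sum_(i < p ^ k) mu (padic_closed_ball i%:R k))%E.
  apply: (@content_subadditive _ _ _ mu _ (fun i => padic_closed_ball i%:R k)).
  - by move=> i _; exact: measurable_padic_closed_ball.
  - exact: measurable_padic_integers.
  - move=> x /padic_integers_cover -/(_ k) [i ik xi].
    by rewrite -(bigcup_mkord _ (fun i : nat => padic_closed_ball i%:R k)); exists i.
rewrite (haar_integers mu_haar) big1 => [|i _]; last by rewrite haar_closed_ball_center.
by rewrite leNgt lte01.
Qed.

End PadicMeasurability.

(** * Comparison of the zeta functions at s = 1 *)

(** A gap c on B contributes at least c mu(B) > 0 to the difference of the
    integrals. *)
Lemma lt_Rintegral (d : measure_display) (T : measurableType d) (R : realType)
    (mu : {measure set T -> \bar R}) (D B : set T) (f g : T -> R) (c : R) :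
  measurable D -> measurable B -> B `<=` D -> (0 < mu B < +oo)%E ->
  mu.-integrable D (EFin \o f) -> mu.-integrable D (EFin \o g) ->
  (forall x, D x -> f x <= g x) -> 0 < c -> (forall x, B x -> f x + c <= g x) ->
  \int[mu]_(x in D) f x < \int[mu]_(x in D) g x.
Proof.
move=> mD mB BD /andP[B0 Boo] fi gi fg c0 fcg.
rewrite -subr_gt0 -RintegralB //.
have gfi : mu.-integrable D (EFin \o (fun x => g x - f x)).
  exact: (integrableB mD gi fi).
have mgf : measurable_fun D (fun x => g x - f x).
  by apply/measurable_EFinP; case/integrableP: gfi.
have muB : (0 < c%:E * mu B)%E by rewrite mule_gt0.
rewrite /Rintegral fine_gt0 // (lt_le_trans muB) /=.
  rewrite ltey_eq; apply/orP; left; exact: integrable_fin_num.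
rewrite -integral_cst //.
apply: (@le_trans _ _ (\int[mu]_(x in B) (g x - f x)%:E)%E).
  apply: ge0_le_integral => //=.
  - by move=> x _; rewrite lee_fin ltW.
  - by apply/measurable_EFinP; exact: measurable_funS mgf.
  - by move=> x Bx; rewrite lee_fin lerBrDl fcg.
apply: ge0_subset_integral => //=; first exact/measurable_EFinP.
by move=> x Dx; rewrite lee_fin subr_ge0 fg.
Qed.

Lemma Re_igusa_integrand1 (R : realType) (p : nat) (p_pr : prime p)
    (g : restricted_series p_pr) (x : padic p_pr) :
  complex.Re (igusa_integrand g (1 : R[i]) x) = ratr (padic_abs (series_eval g x)).
Proof.
rewrite /igusa_integrand /cpow; case: ifPn => [/eqP -> //|a0] /=.
rewrite mul0r cos0 mulr1 mul1r lnK // posrE lt_neqAle eq_sym a0 /=.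
by rewrite ler0q padic_abs_ge0.
Qed.

Section ZetaAtOne.
Variables (R : realType) (p : nat) (p_pr : prime p).
Variable mu : {measure set (padic_borel p_pr) -> \bar R}.
Hypothesis mu_haar : normalized_haar mu.
Local Notation Z_p := (@padic_integers p p_pr : set (padic_borel p_pr)).
Local Notation f := (f_series p_pr).

Lemma integrable_padic_bounded (h : padic_borel p_pr -> R) :
  measurable_fun Z_p h ->
  (forall x, Z_p x -> 0 <= h x <= 1) ->
  mu.-integrable Z_p (EFin \o h).
Proof.
move=> mh h01; apply: measurable_bounded_integrable => //.
- exact: measurable_padic_integers.
- by rewrite (haar_integers mu_haar) ltry.
- exists 1; split=> // M M1 x /h01/andP[h0 h1] /=.
  by rewrite ger0_norm // (le_trans h1) // ltW.
Qed.

Lemma igusa_zeta_truncate_neq D : (0 < D)%N ->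
  ~ igusa_zeta_eq mu (truncate_series f (2 * D)) f.
Proof.
move=> D0 /(_ (1 : R[i]) ltr01) /(congr1 (@complex.Re R)) /= /eqP.
apply/negP; rewrite gt_eqF //.
under eq_Rintegral do rewrite Re_igusa_integrand1.
under [ltRHS]eq_Rintegral do rewrite Re_igusa_integrand1.
set F := fun x : padic_borel p_pr => ratr (padic_abs (x - 1)) ^+ 2 : R.
set c : R := p%:R ^- (2 * D).-1.
have p0 : 0 < p%:R :> R by rewrite ltr0n prime_gt0.
have p1 : 1 < p%:R :> R by rewrite ltr1n prime_gt1.
have c0 : 0 < c by rewrite invr_gt0 exprn_gt0.
have c1 : c <= 1 by rewrite invf_le1 ?exprn_gt0 // exprn_ege1 // ltW.
have fE x : Z_p x -> ratr (padic_abs (series_eval f x)) = F x.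
  by move=> x1; rewrite padic_abs_f // rmorphXn.
have tE x : Z_p x ->
    ratr (padic_abs (series_eval (truncate_series f (2 * D)) x)) = Num.max (F x) c.
  move=> x1; rewrite padic_abs_truncate_f // maxEle; rewrite (fun_if ratr).
  rewrite -(ler_rat R) fmorphV !rmorphXn /= rmorph_nat -/(F x) -/c.
  by rewrite maxEle.
under eq_Rintegral => x /set_mem x1 do rewrite fE //.
under [ltRHS]eq_Rintegral => x /set_mem x1 do rewrite tE //.
have F01 x : Z_p x -> 0 <= F x <= 1.
  move=> x1; rewrite sqr_ge0 /= exprn_ile1 // ?ler0q ?padic_abs_ge0 //.
  rewrite -(rmorph1 (@ratr R)) ler_rat; apply: le_trans (padic_absB _ _) _.
  by rewrite ge_max padic_abs1 x1 lexx.
have ball_int : padic_closed_ball 1 D `<=` Z_p.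
  move=> x xB; rewrite /padic_integers /= -[x](subrK 1).
  apply: le_trans (padic_absD _ _) _; rewrite padic_abs1 ge_max lexx andbT.
  apply: le_trans xB _; rewrite invf_le1 ?exprn_gt0 ?ltr0n ?prime_gt0 //.
  by rewrite exprn_ege1 // ler1n prime_gt0.
have mF A : measurable_fun A F.
  by apply: measurable_funX; apply: measurable_funTS; exact: measurable_padic_abs.
(* On the ball |x - 1| <= p^-D one has |f(x)| <= p^-2D < c. *)
apply: (@lt_Rintegral _ _ _ mu _ (padic_closed_ball 1 D) _ _ (c - p%:R ^- (2 * D))).
- exact: measurable_padic_integers.
- exact: measurable_padic_closed_ball.
- exact: ball_int.
- rewrite haar_closed_ball_gt0 //=.
  apply: (@le_lt_trans _ _ 1%E); last exact: ltry.
  rewrite -(haar_integers mu_haar); apply: le_measure => //; rewrite inE.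
    exact: measurable_padic_closed_ball.
  exact: measurable_padic_integers.
- exact: integrable_padic_bounded.
- apply: integrable_padic_bounded; first exact: measurable_maxr.
  by move=> x /F01/andP[h0 h1]; rewrite le_max h0 ge_max h1.
- by move=> x _; rewrite le_max lexx.
- by rewrite subr_gt0 ltf_pV2 ?posrE ?exprn_gt0 // ltr_eXn2l //; lia.
- move=> x xB.
  have Fx : F x <= p%:R ^- (2 * D).
    rewrite mulnC exprM -exprVn /F.
    rewrite lerXn2r ?nnegrE ?ler0q ?padic_abs_ge0 ?invr_ge0 ?exprn_ge0 //.
    by rewrite -(rmorph_nat (@ratr R)) -rmorphXn -fmorphV ler_rat.
  by rewrite le_max; apply/orP; right; lra.
Qed.
End ZetaAtOne.

Theorem mainTheorem1 (R : realType) (p : nat) (p_pr : prime p)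
    (mu : {measure set (padic_borel p_pr) -> \bar R})
    (mu_haar : normalized_haar mu) :
  (forall D : nat, (1 <= D)%N ->
     ~ igusa_zeta_eq mu (truncate_series (f_series p_pr) (2 * D))
                        (f_series p_pr)) /\
  ~ (exists N : nat, forall d : nat, (N <= d)%N ->
       igusa_zeta_eq mu (truncate_series (f_series p_pr) d) (f_series p_pr)).
Proof.
have neq := igusa_zeta_truncate_neq mu_haar.
split; first exact: neq.
case=> N stable; apply: (neq N.+1 isT).
by apply: (stable (2 * N.+1)%N); lia.
Qed.
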